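(* Let $n,m\ge1$, let $\mathbb{U}$ be an input space, let $f:\mathbb{R}^n\times\mathbb{U}\to\mathbb{R}^m$ and $h:\mathbb{R}^n\to\mathbb{Y}$ be known measurable functions, and let $\Sigma\in\mathbb{R}^{n\times n}$ be a symmetric positive definite covariance matrix. For $\theta\in\mathbb{R}^{m\times n}$ let $\mathbf M(\theta)$ be the system $x_{k+1}=\theta^{\top}f(x_k,u_k)+w_k$, $y_k=h(x_k)$, with state space $\mathbb{R}^n$ and i.i.d. $w_k\sim\mathcal N(0,\Sigma)$, i.e. transition kernel $\mathbf t(dx^+\mid x,u;\theta)=\mathcal N(dx^+\mid\theta^{\top}f(x,u),\Sigma)$. Given data $\mathcal D$, let $\hat\theta\in\mathbb{R}^{m\times n}$, $\Sigma_N$ and $\Theta$ be the Bayesian linear regression estimate, posterior covariance and credible set at confidence $1-\alpha\in(0,1)$ (defined in the context), and let $\widehat{\mathbf M}=\mathbf M(\hat\theta)$, i.e. $\hat x_{k+1}=\hat\theta^{\top}f(\hat x_k,\hat u_k)+\hat w_k$, $\hat y_k=h(\hat x_k)$, $\hat w_k\sim\mathcal N(0,\Sigma)$, with the same initial state as $\mathbf M(\theta)$. Use the interface function $u=\hat u$ (i.e. $\mathcal I(\cdot\mid\hat x,x,\hat u)=\delta_{\hat u}$), the relation $\mathcal R=\{(\hat x,x)\in\mathbb{R}^n\times\mathbb{R}^n: \hat x=x\}$, and for $\theta\in\Theta$ the sub-probability kernel $$\boldsymbol v(A\mid\hat x,x,\hat u;\theta)=\int_{\mathbb{R}^n}\mathbf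 1_A\big(\hat\theta^{\top}f(\hat x,\hat u)+\gamma+w,\ \theta^{\top}f(x,\hat u)+w\big)\min\{\phi_\Sigma(w),\phi_\Sigma(w+\gamma)\}\,dw,$$ where $\gamma=\gamma(x,\hat u,\theta):=(\theta-\hat\theta)^{\top}f(x,\hat u)$ and $\phi_\Sigma$ is the density of $\mathcal N(0,\Sigma)$. Then for every $\theta\in\Theta$: (i) $\widehat{\mathbf M}$ is in an $(\varepsilon,\delta)$-sub-simulation relation with $\mathbf M(\theta)$ with $\varepsilon=0$ and state-dependent $$\delta(\hat x,\hat u)=1-2\,\mathrm{cdf}\Big(-\tfrac{\sqrt r}{2}\,\|f(\hat x,\hat u)\|\Big),\qquad r:=\|\Sigma^{-1}\|\,\|\Sigma_N\|\cdot n\cdot\chi^{-1}(1-\alpha\mid n),$$ meaning: $(\hat x_0,x_0)\in\mathcal R$; for all $(\hat x,x)\in\mathcal R$ and $\hat u\in\mathbb{U}$, $\boldsymbol v(\cdot\mid\hat x,x,\hat u;\theta)$ is a measure on $\mathbb{R}^n\times\mathbb{R}^n$ with $1\ge\boldsymbol v(\mathbb{R}^n\times\mathbb{R}^n)=\boldsymbol v(\mathcal R)\ge1-\delta(\hat x,\hat u)$, $\boldsymbol v(A\times\mathbb{R}^n)\le\mathcal N(A\mid\hat\theta^{\top}f(\hat x,\hat u),\Sigma)$ and $\boldsymbol v(\mathbb{R}^n\times B)\le\mathcal N(B\mid\theta^{\top}f(x,\hat u),\Sigma)$ for all measurable $A,B$; and $h(\hat x)=h(x)$ on $\mathcal R$;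 (ii) the deterministic, $\theta$-independent state mapping $\mathbf s(\cdot\mid\hat x,x,x^+,\hat u)=\delta_{x^{+}+\hat\theta^{\top}(f(\hat x,\hat u)-f(x,\hat u))}$ defines a valid control refinement, i.e. for all $(\hat x,x)\in\mathcal R$, $\hat u\in\mathbb{U}$ and measurable $A\subset\mathbb{R}^n\times\mathbb{R}^n$, $$\int_{\mathbb{R}^n}\mathbf 1_A\big(x^{+}+\hat\theta^{\top}(f(\hat x,\hat u)-f(x,\hat u)),\,x^{+}\big)\,\mathcal N(dx^{+}\mid\theta^{\top}f(x,\hat u),\Sigma)\ \ge\ \boldsymbol v(A\mid\hat x,x,\hat u;\theta).$$
   Context: Bayesian linear regression: the data are $\mathcal D=\{(x^{(i)},u^{(i)},x^{+(i)})\}_{i=1}^N$ with $x^{+(i)}=\theta^{\ast\top}f(x^{(i)},u^{(i)})+w^{(i)}$. Write $\theta=[\theta_1,\dots,\theta_n]$ with columns $\theta_j\in\mathbb{R}^m$ and $\bar\theta=[\theta_1;\dots;\theta_n]\in\mathbb{R}^{nm}$. With prior $\mathcal N(\bar\theta\mid\mu_0,\Sigma_0)$, design matrix $\Phi\in\mathbb{R}^{N\times m}$ with rows $f(x^{(i)},u^{(i)})^{\top}$, and $X^+$ the stacked vector $[x^{+(1)}_1;\dots;x^{+(N)}_1;\dots;x^{+(1)}_n;\dots;x^{+(N)}_n]$, the posterior is $\mathcal N(\bar\theta\mid\mu_N,\Sigma_N)$ with $\Sigma_N^{-1}=\Sigma_0^{-1}+\Sigma^{-1}\otimes\Phi^{\top}\Phi$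 and $\mu_N=\Sigma_N(\Sigma_0^{-1}\mu_0+(\Sigma^{-1}\otimes\Phi^{\top})X^+)$ ($\otimes$ the Kronecker product). The estimate $\hat\theta\in\mathbb{R}^{m\times n}$ has columns the consecutive $m$-blocks of $\mu_N$. The credible set is $\Theta=\{\theta\in\mathbb{R}^{m\times n}:(\bar\theta-\mu_N)^{\top}\Sigma_N^{-1}(\bar\theta-\mu_N)\le n\,\chi^{-1}(1-\alpha\mid n)\}$, where $\chi^{-1}(\cdot\mid n)$ is the quantile function of the chi-squared distribution with $n$ degrees of freedom. $\mathrm{cdf}$ is the standard normal cumulative distribution function, $\|\cdot\|$ is the Euclidean norm on vectors and the induced spectral norm on matrices, $\mathcal N(\cdot\mid\mu,\Sigma)$ the Gaussian measure, and $\delta_a$ the Dirac measure at $a$. *)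

(* Defs.v *)
From HB Require Import structures.
From mathcomp Require Import all_boot all_order all_algebra.
From mathcomp Require Import all_classical all_reals all_analysis.
Set Implicit Arguments.
Unset Strict Implicit.
Unset Printing Implicit Defensive.
Import Order.TTheory GRing.Theory Num.Theory.
Import numFieldNormedType.Exports.
Local Open Scope classical_set_scope.
Local Open Scope ring_scope.

Section Defs.
Variable R : realType.

(** Borel sigma-algebra on R^n (column vectors), generated by boxes
    (products of Borel subsets of R). *)
Definition boxes (n : nat) : set (set 'cV[R]_n) :=
  [set B | exists Bi : 'I_n -> set R,
     (forall i, measurable (Bi i)) /\ B = [set v : 'cV[R]_n | forall i, Bi i (v i ord0)]].

Definition Rn (n : nat) := g_sigma_algebraType (@boxes n).

Definition enorm (n : nat) (v : 'cV[R]_n) : R :=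
  Num.sqrt (\sum_i v i ord0 ^+ 2).

Definition specnorm (p q : nat) (M : 'M[R]_(p, q)) : R :=
  sup [set enorm (M *m x) | x in [set x : 'cV[R]_q | enorm x <= 1]].

(** Lebesgue integral over R^n of a nonnegative function, as iterated
    one-dimensional Lebesgue integrals (Tonelli). *)
Fixpoint lebint (n : nat) : ('cV[R]_n -> \bar R) -> \bar R :=
  match n return ('cV[R]_n -> \bar R) -> \bar R with
  | 0 => fun g => g 0
  | n'.+1 => fun g =>
      (\int[@lebesgue_measure R]_t
          lebint (fun v : 'cV[R]_n' => g (col_mx (const_mx t : 'cV_1) v)))%E
  end.

Definition gauss_density (n : nat) (S : 'M[R]_n) (w : 'cV[R]_n) : R :=
  (Num.sqrt ((pi *+ 2) ^+ n * \det S))^-1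
  * expR (- ((w^T *m invmx S *m w) ord0 ord0) / 2).

Definition gauss_int (n : nat) (mu : 'cV[R]_n) (S : 'M[R]_n)
  (g : 'cV[R]_n -> \bar R) : \bar R :=
  lebint (fun x => (g x * (gauss_density S (x - mu))%:E)%E).

Definition gauss (n : nat) (mu : 'cV[R]_n) (S : 'M[R]_n)
  (A : set 'cV[R]_n) : \bar R :=
  gauss_int mu S (fun x => (\1_A x)%:E).

Definition normal_cdf (t : R) : R := fine (normal_prob 0 1 `]-oo, t]).

Definition chi2_cdf (n : nat) (t : R) : R :=
  fine (gauss (0 : 'cV[R]_n) 1%:M [set x | enorm x ^+ 2 <= t]).

Definition chi2_quantile (n : nat) (p : R) : R :=
  inf [set t : R | p <= chi2_cdf n t].

(** Kronecker product, with the index convention of mxvec_index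
    (row index (i1,i2) |-> i1 * r + i2). *)
Definition kron_idx (p r : nat) (k : 'I_(p * r)) : 'I_p * 'I_r :=
  enum_val (cast_ord (esym (mxvec_cast p r)) k).

Definition kron (p q r s : nat) (A : 'M[R]_(p, q)) (B : 'M[R]_(r, s))
  : 'M[R]_(p * r, q * s) :=
  \matrix_(i, j) (A (kron_idx i).1 (kron_idx j).1 * B (kron_idx i).2 (kron_idx j).2).

Definition sym_posdef (n : nat) (S : 'M[R]_n) : Prop :=
  S^T = S /\ forall v : 'cV[R]_n, v != 0 -> 0 < (v^T *m S *m v) ord0 ord0.

Section BLR.
Variables (n m N : nat) (U : Type) (f : 'cV[R]_n -> U -> 'cV[R]_m).
Variables (S : 'M[R]_n) (mu0 : 'cV[R]_(n * m)) (S0 : 'M[R]_(n * m)).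
Variables (xs : 'I_N -> 'cV[R]_n) (us : 'I_N -> U) (xps : 'I_N -> 'cV[R]_n).

Definition design : 'M[R]_(N, m) := \matrix_(i, k) f (xs i) (us i) k ord0.

(* X^+ = [x^+(1)_1; ...; x^+(N)_1; ...; x^+(1)_n; ...; x^+(N)_n] *)
Definition Xplus : 'cV[R]_(n * N) := (mxvec (\matrix_(j, i) xps i j ord0))^T.

Definition SigmaN : 'M[R]_(n * m) :=
  invmx (invmx S0 + kron (invmx S) (design^T *m design)).

Definition muN : 'cV[R]_(n * m) :=
  SigmaN *m (invmx S0 *m mu0 + kron (invmx S) design^T *m Xplus).

(* columns of thetahat are the consecutive m-blocks of muN *)
Definition thetahat : 'M[R]_(m, n) := (vec_mx muN^T)^T.
End BLR.

(* thetabar = [theta_1; ...; theta_n] (columns stacked) *)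
Definition thetabar (m n : nat) (th : 'M[R]_(m, n)) : 'cV[R]_(n * m) :=
  (mxvec th^T)^T.

Definition credible_set (n m : nat) (mu : 'cV[R]_(n * m)) (SN : 'M[R]_(n * m))
  (alpha : R) : set 'M[R]_(m, n) :=
  [set th | ((thetabar th - mu)^T *m invmx SN *m (thetabar th - mu)) ord0 ord0
            <= n%:R * chi2_quantile n (1 - alpha)].

Definition Rrel (n : nat) : set ('cV[R]_n * 'cV[R]_n) := [set p | p.1 = p.2].

(** The sub-probability kernel v(A | xh, x, u; theta) built from the
    coupling of N(thh^T f(xh,u) , S) and N(th^T f(x,u), S). *)
Definition vker (n m : nat) (U : Type) (f : 'cV[R]_n -> U -> 'cV[R]_m)
  (thh th : 'M[R]_(m, n)) (S : 'M[R]_n) (xh x : 'cV[R]_n) (u : U)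
  (A : set ('cV[R]_n * 'cV[R]_n)) : \bar R :=
  let gam := (th - thh)^T *m f x u in
  lebint (fun w : 'cV[R]_n =>
    (\1_A (thh^T *m f xh u + gam + w, th^T *m f x u + w)
     * Num.min (gauss_density S w) (gauss_density S (w + gam)))%:E).

End Defs.

(* Main.v *)
Require Import Defs.
From HB Require Import structures.
From mathcomp Require Import all_boot all_order all_algebra.
From mathcomp Require Import all_classical all_reals all_analysis.
From mathcomp Require Import measurable_realfun ring lra.
Import Order.TTheory GRing.Theory Num.Theory.
Import numFieldNormedType.Exports.
Local Open Scope classical_set_scope.
Local Open Scope ring_scope.

(** The minimum of the densities of N(0, S) at w and w + g (with g = gamma) is
    phi(w + g) on one side of the hyperplane bisecting 0 and -g in the metric S^-1,
    and phi(w) on the other. A linear functional of a Gaussian vector is Gaussian,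
    so the total mass of v is 2 cdf(-c / 2) with c^2 = g^T S^-1 g. For theta in the
    credible set, c^2 <= ||S^-1|| |theta - hat theta|_F^2 |f|^2 <= r |f|^2, because
    |d|^2 <= ||Sigma_N|| d^T Sigma_N^-1 d by Cauchy-Schwarz for Sigma_N^-1. The
    remaining claims bound the minimum by one of the two densities and translate. *)

(** * Iterated Lebesgue integrals *)

(** Integration on R^n is iterated integration over the coordinates, so reducing [S] to the identity
    by a linear change of variables would itself have to be proved coordinate by coordinate. The
    proof relies only on affine substitutions on R and translations of R^n. This is why the law of a
    linear functional is found by eliminating one coordinate at a time through Schur complements,
    and why the minimum of the densities is split into two terms that each depend on one linear
    functional. That functional is a = S^-1 g: its variance a^T S a is c^2, and it takes the value
    -c^2/2 on the bisecting hyperplane, so standardising gives the threshold c/2. *)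

Section MeasurableRn.
Context {R : realType} {d : measure_display} {T : measurableType d}.

Lemma measurable_coord n (i : 'I_n) :
  measurable_fun [set: Rn R n] (fun v : Rn R n => v i ord0).
Proof.
move=> _ Y mY; rewrite setTI; apply: sub_sigma_algebra.
exists (fun j => if j == i then Y else setT); split.
  by move=> j; case: ifP.
apply/seteqP; split=> v /=.
  by move=> Yv j; case: eqP => [->|].
by move=> /(_ i); rewrite eqxx.
Qed.

(** Boxes generate the sigma-algebra, and the preimage of a box is a finite intersection of
    preimages under the coordinates. *)
Lemma measurable_fun_Rn n (g : T -> Rn R n) :
  (forall i, measurable_fun [set: T] (fun x => g x i ord0)) ->
  measurable_fun [set: T] g.
Proof.
move=> mg; apply: (@measurability _ _ T (Rn R n) setT g (@boxes R n)) => //.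
move=> _ [_ [B [mB ->] <-]]; rewrite setTI.
rewrite (_ : _ @^-1` _ = \bigcap_(i in [set: 'I_n]) [set x | B i (g x i ord0)]).
  apply: fin_bigcap_measurable => // i _.
  by rewrite -[X in measurable X]setTI; exact: mg.
by apply/seteqP; split=> x /= Bx i; [move=> _|]; exact: Bx.
Qed.

Lemma measurable_mulmx n p (A : 'M[R]_(p, n)) (g : T -> Rn R n) :
  measurable_fun [set: T] g ->
  measurable_fun [set: T] (fun x => A *m g x : Rn R p).
Proof.
move=> mg; apply: measurable_fun_Rn => i.
under eq_fun do rewrite mxE.
apply: measurable_sum => j; apply: measurable_funM; first exact: measurable_cst.
exact: (measurableT_comp (measurable_coord n j) mg).
Qed.

Lemma measurable_addmx n (g h : T -> Rn R n) :
  measurable_fun [set: T] g -> measurable_fun [set: T] h ->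
  measurable_fun [set: T] (fun x => g x + h x : Rn R n).
Proof.
move=> mg mh; apply: measurable_fun_Rn => i.
under eq_fun do rewrite mxE.
by apply: measurable_funD; exact: measurableT_comp (measurable_coord n i) _.
Qed.

Lemma measurable_cons n (t : T -> R) (g : T -> Rn R n) :
  measurable_fun [set: T] t -> measurable_fun [set: T] g ->
  measurable_fun [set: T]
    (fun x => col_mx (const_mx (t x) : 'cV_1) (g x) : Rn R n.+1).
Proof.
move=> mt mg; apply: measurable_fun_Rn => i.
case: (splitP (i : 'I_(1 + n))) => j ij.
  rewrite (_ : (fun _ => _) = t)//; apply/funext => x.
  rewrite (_ : i = lshift n j :> 'I_(1 + n)); last exact: val_inj.
  by rewrite (@col_mxEu _ 1 n) mxE.
rewrite (_ : (fun _ => _) = fun x => g x j ord0).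
  exact: measurableT_comp (measurable_coord n j) _.
apply/funext => x; rewrite (_ : i = rshift 1 j :> 'I_(1 + n)); last exact: val_inj.
by rewrite (@col_mxEd _ 1 n).
Qed.

End MeasurableRn.

Section Lebint.
Context {R : realType}.
Local Open Scope ereal_scope.
Implicit Types n : nat.

Lemma eq_lebint n (g h : 'cV[R]_n -> \bar R) : g =1 h -> lebint g = lebint h.
Proof. by move=> /funext ->. Qed.

Lemma lebint_ge0 n (g : 'cV[R]_n -> \bar R) : (forall v, 0 <= g v) -> 0 <= lebint g.
Proof.
by elim: n g => [|n IH] g g0 //=; apply: integral_ge0 => t _; exact: IH.
Qed.

(** The parameter space [T] varies in the induction: the first coordinate is moved into it, the
    induction hypothesis is used over T x R, and Tonelli gives measurability of the outer
    integral. *)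
Lemma measurable_lebint n d (T : measurableType d) (g : T * Rn R n -> \bar R) :
  measurable_fun [set: T * Rn R n] g -> (forall p, 0 <= g p) ->
  measurable_fun [set: T] (fun x => lebint (fun v => g (x, v))).
Proof.
elim: n d T g => [|n IH] d T g mg g0 /=.
  exact: (measurableT_comp mg).
pose h (p : T * measurableTypeR R) : \bar R :=
  lebint (fun v : 'cV_n => g (p.1, col_mx (const_mx p.2 : 'cV_1) v)).
apply: (@measurable_fun_fubini_tonelli_F _ _ T (measurableTypeR R) R
  (@lebesgue_measure R) h); last by move=> p; apply: lebint_ge0.
pose k (q : (T * measurableTypeR R) * Rn R n) : \bar R :=
  g (q.1.1, col_mx (const_mx q.1.2 : 'cV_1) q.2).
apply: (IH _ _ k) => [|p]; last exact: g0.
apply: (measurableT_comp mg); apply: measurable_fun_pair.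
  exact: measurableT_comp.
by apply: measurable_cons => //; exact: measurableT_comp.
Qed.

(** Together with [measurable_section], this supplies the side conditions of the inductions on the
    dimension. *)
Lemma measurable_slice n (g : Rn R n.+1 -> \bar R) :
  measurable_fun [set: Rn R n.+1] g -> (forall v, 0 <= g v) ->
  measurable_fun [set: measurableTypeR R]
    (fun t => lebint (fun v : 'cV_n => g (col_mx (const_mx t : 'cV_1) v))).
Proof.
move=> mg g0.
pose k (q : measurableTypeR R * Rn R n) : \bar R :=
  g (col_mx (const_mx q.1 : 'cV_1) q.2).
apply: (@measurable_lebint _ _ _ k) => [|p]; last exact: g0.
by apply: (measurableT_comp mg); exact: measurable_cons.
Qed.

Lemma measurable_section n (g : Rn R n.+1 -> \bar R) (t : R) :
  measurable_fun [set: Rn R n.+1] g ->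
  measurable_fun [set: Rn R n] (fun v => g (col_mx (const_mx t : 'cV_1) v)).
Proof.
move=> mg; apply: (measurableT_comp mg); apply: measurable_cons => //.
Qed.

Lemma le_lebint n (g h : Rn R n -> \bar R) :
  measurable_fun [set: Rn R n] g -> measurable_fun [set: Rn R n] h ->
  (forall v, 0 <= g v) -> (forall v, g v <= h v) -> lebint g <= lebint h.
Proof.
elim: n g h => [|n IH] g h mg mh g0 gh //=.
have h0 v : 0 <= h v := le_trans (g0 v) (gh v).
apply: ge0_le_integral => //.
- by move=> t _; exact: lebint_ge0.
- exact: measurable_slice.
- exact: measurable_slice.
- by move=> t _; apply: IH => //; exact: measurable_section.
Qed.

Lemma lebintD n (g h : Rn R n -> \bar R) :
  measurable_fun [set: Rn R n] g -> measurable_fun [set: Rn R n] h ->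
  (forall v, 0 <= g v) -> (forall v, 0 <= h v) ->
  lebint (fun v => g v + h v) = lebint g + lebint h.
Proof.
elim: n g h => [|n IH] g h mg mh g0 h0 //=.
rewrite -ge0_integralD//.
- by apply: eq_integral => t _; rewrite IH//; exact: measurable_section.
- by move=> t _; exact: lebint_ge0.
- exact: measurable_slice.
- by move=> t _; exact: lebint_ge0.
- exact: measurable_slice.
Qed.

Lemma lebintZl n (k : R) (g : Rn R n -> \bar R) : (0 <= k)%R ->
  measurable_fun [set: Rn R n] g -> (forall v, 0 <= g v) ->
  lebint (fun v => k%:E * g v) = k%:E * lebint g.
Proof.
elim: n g => [|n IH] g k0 mg g0 //=.
rewrite -ge0_integralZl_EFin//.
- by apply: eq_integral => t _; rewrite IH//; exact: measurable_section.
- by move=> t _; exact: lebint_ge0.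
- exact: measurable_slice.
Qed.

Lemma lebint0 n : lebint (fun _ : 'cV[R]_n => 0) = 0.
Proof.
by elim: n => [|n IH] //=; apply: integral0_eq => t _.
Qed.

Lemma lebint_nneseries n (g : nat -> Rn R n -> \bar R) :
  (forall k, measurable_fun [set: Rn R n] (g k)) -> (forall k v, 0 <= g k v) ->
  lebint (fun v => \sum_(0 <= k <oo) g k v) = \sum_(0 <= k <oo) lebint (g k).
Proof.
elim: n g => [|n IH] g mg g0 //=.
rewrite -integral_nneseries//.
- by apply: eq_integral => t _; rewrite IH// => k; exact: measurable_section.
- by move=> k; exact: measurable_slice.
- by move=> k t _; exact: lebint_ge0.
Qed.

End Lebint.

(** * Affine substitution on R and translation invariance on R^n *)

Section Affine.
Context {R : realType}.
Local Notation leb := (@lebesgue_measure R).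

Lemma measurable_affine (s c : R) :
  measurable_fun [set: measurableTypeR R] (fun t : measurableTypeR R => s * t + c).
Proof. by apply: measurable_funD => //; exact: mulrl_measurable. Qed.

(** The right-hand side is a measure in [A] that gives ]a, b] its length, and Lebesgue measure is
    the only such measure. *)
Lemma lebesgue_measure_affine (s c : R) : s != 0 ->
  forall A : set (measurableTypeR R), measurable A ->
  leb A = (`|s|%:E * leb ((fun t => (s * t + c)%R) @^-1` A))%E.
Proof.
move=> s0 A mA.
pose k : {nonneg R} := NngNum (normr_ge0 s).
have -> : (`|s|%:E * leb ((fun t => (s * t + c)%R) @^-1` A))%E =
    pushforward (mscale k leb)
      (fun t => s * t + c : measurableTypeR R) A by [].
apply: lebesgue_measure_unique => //; first exact: measurable_affine.
move=> mf _ [[a b] _ <-]; rewrite /= /pushforward /mscale/=.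
have [slt0|sgt0|sE] := ltgtP s 0; last by rewrite sE eqxx in s0.
  (* A negative slope reverses the interval, so the closed end changes side; the length is
     unaffected. *)
  rewrite (_ : _ @^-1` _ = `[(b - c) / s, (a - c) / s[%classic); last first.
    apply/seteqP; split => t/=; rewrite !in_itv/= => /andP[h1 h2]; apply/andP;
    split.
    - by rewrite ler_ndivrMr//; lra.
    - by rewrite ltr_ndivlMr//; lra.
    - by move: h2; rewrite ltr_ndivlMr//; lra.
    - by move: h1; rewrite ler_ndivrMr//; lra.
  rewrite !lebesgue_measure_itv/= !lte_fin ltr_nM2r ?invr_lt0// ltrD2r.
  case: ifP => _; last by rewrite mule0.
  rewrite -!EFinB -EFinM; congr EFin; rewrite ltr0_norm//.
  by field.
rewrite (_ : _ @^-1` _ = `](a - c) / s, (b - c) / s]%classic); last first.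
  apply/seteqP; split => t/=; rewrite !in_itv/= => /andP[h1 h2]; apply/andP;
  split.
  - by rewrite ltr_pdivrMr//; lra.
  - by rewrite ler_pdivlMr//; lra.
  - by move: h1; rewrite ltr_pdivrMr//; lra.
  - by move: h2; rewrite ler_pdivlMr//; lra.
rewrite !lebesgue_measure_itv/= !lte_fin ltr_pM2r ?invr_gt0// ltrD2r.
case: ifP => _; last by rewrite mule0.
rewrite -!EFinB -EFinM; congr EFin; rewrite gtr0_norm//.
by field.
Qed.

Lemma ge0_integral_affine (s c : R) (g : R -> \bar R) : s != 0 ->
  measurable_fun [set: measurableTypeR R] g -> (forall t, (0 <= g t)%E) ->
  (\int[leb]_t g (s * t + c)%R = (`|s|^-1)%R%:E * \int[leb]_t g t)%E.
Proof.
move=> s0 mg g0.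
pose k : {nonneg R} := NngNum (normr_ge0 s).
have E : (\int[leb]_t g t = `|s|%R%:E * \int[leb]_t g (s * t + c)%R)%E.
  rewrite -(@ge0_integral_mscale _ _ _ leb setT _ k)//; last first.
    exact: (measurableT_comp mg (measurable_affine s c)).
  transitivity (\int[pushforward (mscale k leb)
      (fun t => (s * t + c)%R : measurableTypeR R)]_t g t)%E.
    apply: eq_measure_integral; first exact: measurable_affine.
    by move=> mf A mA _; exact: lebesgue_measure_affine.
  by rewrite ge0_integral_pushforward ?preimage_setT//; exact: measurable_affine.
rewrite E muleA -EFinM mulVf ?mul1e// normr_eq0//.
Qed.

(** The translation acts separately on the tail, where the induction hypothesis absorbs it, and on
    the first coordinate, where it is a substitution of slope 1. *)
Lemma lebint_translate n (a : 'cV[R]_n) (g : Rn R n -> \bar R) :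
  measurable_fun [set: Rn R n] g -> (forall v, (0 <= g v)%E) ->
  lebint (fun v : 'cV[R]_n => g (v + a)) = lebint g.
Proof.
elim: n a g => [|n IH] a g mg g0 /=; first by rewrite (flatmx0 (0 + a)).
pose a1 := a ord0 ord0; pose a2 := dsubmx (a : 'cV_(1 + n)).
have aE (t : R) (v : 'cV[R]_n) : col_mx (const_mx t : 'cV_1) v + a =
    col_mx (const_mx (1 * t + a1) : 'cV_1) (v + a2).
  rewrite -[a in LHS](vsubmxK (a : 'cV_(1 + n))) (@add_col_mx _ 1 n).
  congr (@col_mx _ 1 n _ _ _); apply/matrixP => i j; rewrite !mxE mul1r !ord1.
  by rewrite /a1; congr (t + a _ _); exact: val_inj.
under eq_integral do under eq_lebint do rewrite aE.
under eq_integral => t _.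
  rewrite (IH a2 (fun v => g (col_mx (const_mx (1 * t + a1)%R : 'cV_1) v)))//; last first.
    exact: measurable_section.
  over.
rewrite (@ge0_integral_affine 1 a1
  (fun t => lebint (fun v : 'cV_n => g (col_mx (const_mx t : 'cV_1) v))))//.
- by rewrite normr1 invr1 mul1e.
- exact: measurable_slice.
- by move=> t; exact: lebint_ge0.
Qed.

End Affine.

(** * Gaussian integrals *)

Section Convolution.
Context {R : realType}.
Local Notation leb := (@lebesgue_measure R).
Local Notation phi := (@normal_pdf R 0 1).

Lemma normal_pdf01E (t : R) : phi t = (Num.sqrt (pi *+ 2))^-1 * expR (- t ^+ 2 / 2).
Proof.
rewrite normal_pdfE ?oner_eq0// /normal_peak /normal_fun.
by rewrite expr1n mul1r subr0.
Qed.

(** Rotation invariance of the standard Gaussian on the plane. *)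
Lemma normal_pdf01M (s t u v : R) : s ^+ 2 + t ^+ 2 = u ^+ 2 + v ^+ 2 ->
  phi s * phi t = phi u * phi v.
Proof.
move=> E; rewrite !normal_pdf01E mulrACA [RHS]mulrACA -!expRD; congr (_ * expR _).
by rewrite -!mulrDl -!opprD E.
Qed.

Lemma measurable_pdf01 : measurable_fun [set: measurableTypeR R] phi.
Proof. exact: measurable_normal_pdf. Qed.

Lemma integral_pdf01_affine (s c : R) : s != 0 ->
  (\int[leb]_t (phi (s * t + c))%:E = (`|s|^-1)%R%:E)%E.
Proof.
move=> s0; rewrite (@ge0_integral_affine _ s c (EFin \o phi))//=.
- by rewrite integral_normal_pdf mule1.
- by apply/measurable_EFinP; exact: measurable_pdf01.
- by move=> t; rewrite lee_fin normal_pdf_ge0.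
Qed.

Variable G : R -> \bar R.
Hypothesis mG : measurable_fun [set: measurableTypeR R] G.
Hypothesis G0 : forall t, (0 <= G t)%E.

Let mGl (a b : R) : measurable_fun [set: measurableTypeR R]
  (fun t => G (a * t + b) * (phi t)%:E)%E.
Proof.
apply: emeasurable_funM.
  by apply: (measurableT_comp mG); exact: measurable_affine.
by apply/measurable_EFinP; exact: measurable_pdf01.
Qed.

Lemma normal_integral_opp (a : R) :
  (\int[leb]_z (G (- a * z)%R * (phi z)%:E) = \int[leb]_z (G (a * z)%R * (phi z)%:E))%E.
Proof.
have phiN z : phi (- z) = phi z by rewrite !normal_pdf01E sqrrN.
transitivity (\int[leb]_z (G (a * (-1 * z + 0))%R * (phi (-1 * z + 0)%R)%:E))%E.
  by apply: eq_integral => z _; rewrite addr0 mulN1r phiN mulrN mulNr.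
rewrite (@ge0_integral_affine _ (-1) 0 (fun z => G (a * z)%R * (phi z)%:E)%E).
- by rewrite normrN1 invr1 mul1e.
- by rewrite oppr_eq0 oner_eq0.
- by have := mGl a 0; under eq_fun do rewrite addr0.
- by move=> t; rewrite mule_ge0// lee_fin normal_pdf_ge0.
Qed.

(** Needed because the square root in the convolution formula yields |b| when a = 0. *)
Lemma normal_integral_norm (a : R) :
  (\int[leb]_z (G (`|a| * z)%R * (phi z)%:E) = \int[leb]_z (G (a * z)%R * (phi z)%:E))%E.
Proof.
have [|] := leP 0 a => a0; first by rewrite ger0_norm.
by rewrite ltr0_norm// normal_integral_opp.
Qed.

(** The law of a sum of two independent centred Gaussians. Substituting r y = b t + a s in the inner
    integral, exchanging the integrals and using rotation invariance leaves the t-integral of [phi]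
    at an affine function of t; its value |a / r| cancels the Jacobian |r / a|. *)
Lemma normal_convolution (a b : R) :
  (\int[leb]_t ((\int[leb]_s (G (b * t + a * s)%R * (phi s)%:E)) * (phi t)%:E)
  = \int[leb]_z (G (Num.sqrt (a ^+ 2 + b ^+ 2) * z)%R * (phi z)%:E))%E.
Proof.
(* The substitution divides by [a], so the degenerate case is treated apart. *)
have [->|a0] := eqVneq a 0.
  rewrite expr0n/= add0r sqrtr_sqr normal_integral_norm.
  apply: eq_integral => t _; congr (_ * _)%E.
  under eq_integral do rewrite mul0r addr0.
  rewrite ge0_integralZl//.
  - by rewrite integral_normal_pdf mule1.
  - by apply/measurable_EFinP; exact: measurable_pdf01.
  - by move=> z _; rewrite lee_fin normal_pdf_ge0.
set r := Num.sqrt _.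
have r2 : r ^+ 2 = a ^+ 2 + b ^+ 2 by rewrite sqr_sqrtr// addr_ge0 ?sqr_ge0.
have r0 : 0 < r.
  rewrite sqrtr_gt0 ltr_pwDl ?sqr_ge0// exprn_even_gt0//.
have phi0 z : (0 <= (phi z)%:E)%E by rewrite lee_fin normal_pdf_ge0.
have ra0 : r / a != 0 by rewrite mulf_neq0 ?invr_eq0// gt_eqF.
have inner t : (\int[leb]_s (G (b * t + a * s)%R * (phi s)%:E) =
    `|r / a|%:E * \int[leb]_y (G (r * y)%R * (phi ((r * y - b * t) / a))%:E))%E.
  transitivity (\int[leb]_s (G (a * s + b * t)%R * (phi s)%:E))%E.
    by apply: eq_integral => s _; rewrite addrC.
  have := @ge0_integral_affine R (r / a) (- b * t / a)
    (fun s => G (a * s + b * t)%R * (phi s)%:E)%E ra0 (mGl _ _).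
  move=> /(_ (fun t => mule_ge0 (G0 _) (phi0 _))) E.
  have -> : (\int[leb]_y (G (r * y)%R * (phi ((r * y - b * t) / a))%:E) =
     (`|(r / a)%R|^-1)%:E * \int[leb]_t0 (G (a * t0 + b * t)%R * (phi t0)%:E))%E.
    rewrite -E; apply: eq_integral => y _; congr (G _ * (phi _)%:E)%E; field => //.
  by rewrite muleA -EFinM divff ?mul1e// normr_eq0.
have mlin (u v : R) : measurable_fun [set: measurableTypeR R * measurableTypeR R]
    (fun p => u * p.2 + v * p.1 : R).
  apply: measurable_funD.
    exact: (measurableT_comp (mulrl_measurable u) measurable_snd).
  exact: (measurableT_comp (mulrl_measurable v) measurable_fst).
pose h (p : measurableTypeR R * measurableTypeR R) : \bar R :=
  (`|r / a|%:E * (G (r * p.2)%R * (phi ((r * p.2 - b * p.1) / a))%:E) * (phi p.1)%:E)%E.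
have mh : measurable_fun setT h.
  apply: emeasurable_funM; last first.
    by apply/measurable_EFinP; exact: (measurableT_comp measurable_pdf01 measurable_fst).
  apply: emeasurable_funM; first exact: measurable_cst.
  apply: emeasurable_funM.
    by apply: (measurableT_comp mG); have := mlin r 0; under eq_fun do rewrite mul0r addr0.
  apply/measurable_EFinP; apply: (measurableT_comp measurable_pdf01).
  rewrite (_ : (fun _ => _) = fun p : measurableTypeR R * measurableTypeR R =>
    (r / a) * p.2 + (- b / a) * p.1); first exact: mlin.
  by apply/funext => p; field.
have h0 p : (0 <= h p)%E by rewrite /h !mule_ge0.
transitivity (\int[leb]_t \int[leb]_y h (t, y))%E.
  have mg t : measurable_fun [set: measurableTypeR R]
      (fun y => G (r * y)%R * (phi ((r * y - b * t) / a))%:E)%E.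
    apply: emeasurable_funM.
      by apply: (measurableT_comp mG); exact: mulrl_measurable.
    apply/measurable_EFinP; apply: (measurableT_comp measurable_pdf01).
    apply: (measurableT_comp (mulrr_measurable a^-1)).
    exact: measurable_affine.
  apply: eq_integral => t _; rewrite inner /h/=.
  rewrite ge0_integralZr//; last 2 first.
  - by apply: emeasurable_funM => //; exact: measurable_cst.
  - by move=> y _; rewrite !mule_ge0.
  by rewrite ge0_integralZl// => y _; rewrite !mule_ge0.
rewrite (@fubini_tonelli _ _ (measurableTypeR R) (measurableTypeR R) R leb leb h)//.
apply: eq_integral => y _.
transitivity (\int[leb]_t (`|r / a|%:E * (G (r * y)%R * (phi y)%:E) *
    (phi ((r / a) * t + (- b / a * y)))%:E))%E.
  apply: eq_integral => t _; rewrite /h/= -!muleA; congr (_ * (_ * _))%E.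
  rewrite -!EFinM; congr EFin; apply: normal_pdf01M.
  (* The two sums of squares differ by a multiple of r^2 - (a^2 + b^2). *)
  apply/eqP; rewrite -subr_eq0; apply/eqP.
  rewrite (_ : _ - _ = (y ^+ 2 - t ^+ 2) * (r ^+ 2 - (a ^+ 2 + b ^+ 2)) / a ^+ 2).
    by rewrite r2 subrr mulr0 mul0r.
  by field.
rewrite ge0_integralZl//; last 2 first.
- apply/measurable_EFinP; apply: (measurableT_comp measurable_pdf01).
  exact: measurable_affine.
- by rewrite !mule_ge0.
rewrite integral_pdf01_affine// muleAC -EFinM divff ?mul1e//.
by rewrite normr_eq0.
Qed.

End Convolution.

(** * Positive definite matrices and the Schur complement of the first pivot *)

Section PosDef.
Context {R : realType}.

Lemma sym_posdef_unit {n} {S : 'M[R]_n} : sym_posdef S -> S \in unitmx.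
Proof.
move=> [_ Spos]; rewrite unitmxE unitfE; apply/negP => /det0P[v v0 vS].
have := Spos v^T; rewrite trmx_eq0 => /(_ v0).
by rewrite trmxK vS mul0mx mxE ltxx.
Qed.

Lemma sym_posdef_ge0 {n} {S : 'M[R]_n} (v : 'cV[R]_n) : sym_posdef S ->
  0 <= (v^T *m S *m v) ord0 ord0.
Proof.
move=> [_ Spos]; have [->|/Spos/ltW//] := eqVneq v 0.
by rewrite mulmx0 mxE.
Qed.

End PosDef.

Section Schur.
Context {R : realType} {n : nat}.
Variable S : 'M[R]_(1 + n).
Hypothesis Sp : sym_posdef S.

Let s := S ord0 ord0.
Let b : 'cV[R]_n := dlsubmx S.
Let C : 'M[R]_n := drsubmx S - s^-1 *: (b *m b^T).

Lemma schur_block : S = block_mx s%:M b^T b (drsubmx S).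
Proof.
rewrite -[LHS]submxK; congr block_mx.
  rewrite [LHS]mx11_scalar !mxE; congr (S _ _)%:M; exact: val_inj.
by rewrite -{1}(proj1 Sp) trmx_dlsub.
Qed.

Lemma schur_pivot_gt0 : 0 < s.
Proof.
(* The first basis vector picks out the pivot. *)
have := (proj2 Sp) (col_mx 1%:M 0).
rewrite -{2}[0]/(0 : 'cV_n) col_mx_eq0 negb_and.
rewrite schur_block tr_col_mx mul_row_block trmx1 !mul1mx trmx0 !mul0mx !addr0.
rewrite mul_row_col mulmx1 mulmx0 addr0 mxE eqxx mulr1n; apply.
apply/orP; left; apply/negP => /eqP/matrixP/(_ ord0 ord0).
by rewrite !mxE/= => /eqP; rewrite oner_eq0.
Qed.

Let s0 : s != 0. Proof. by rewrite gt_eqF// schur_pivot_gt0. Qed.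

(* Completing the square in the first variable: S = L diag(s, C) L^T. *)
Lemma schur_quadratic (t : R) (v : 'cV[R]_n) :
  ((col_mx t%:M v)^T *m S *m (col_mx t%:M v : 'cV_(1 + n))) ord0 ord0 =
  (v^T *m C *m v) ord0 ord0 + (t + (v^T *m b) ord0 ord0 / s) ^+ 2 * s.
Proof.
rewrite {1}schur_block tr_col_mx mul_row_block mul_row_col tr_scalar_mx.
rewrite !mulmxDl mul_scalar_mx -!mulmxA !mul_scalar_mx.
have bv : (b^T *m v) = ((v^T *m b) ord0 ord0)%:M.
  by rewrite [LHS]mx11_scalar -[v in LHS]trmxK -trmx_mul mxE.
set e := (v^T *m b) ord0 ord0 in bv *.
have vb : v^T *m b = e%:M by rewrite [LHS]mx11_scalar.
have -> : v^T *m (C *m v) = v^T *m (drsubmx S *m v) - (e * e / s)%:M.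
  rewrite /C mulmxBl mulmxBr -scalemxAl -scalemxAr -!mulmxA bv mul_mx_scalar.
  by rewrite -scalemxAr vb !scale_scalar_mx mulrC.
rewrite bv [b *m t%:M]mul_mx_scalar -scalemxAr vb mul_mx_scalar.
rewrite !mxE eqxx !mulr1n.
by field.
Qed.

Lemma schur_sym_posdef : sym_posdef C.
Proof.
split=> [|v v0].
  rewrite /C linearB/= linearZ/= trmx_mul trmxK; congr (_ - _).
  by rewrite trmx_drsub (proj1 Sp).
(* The first entry is chosen to annihilate the square in [schur_quadratic]. *)
have := (proj2 Sp) (col_mx (- ((v^T *m b) ord0 ord0 / s))%:M v).
rewrite schur_quadratic addNr expr0n/= mul0r addr0; apply.
by rewrite col_mx_eq0 negb_and v0 orbT.
Qed.

Lemma schur_det : \det S = s * \det C.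
Proof.
rewrite schur_block.
(* One step of Gaussian elimination; the left factor is unit triangular. *)
have -> : block_mx s%:M b^T b (drsubmx S) =
    block_mx 1%:M 0 (s^-1 *: b) 1%:M *m block_mx s%:M b^T 0 C.
  rewrite mulmx_block !mul1mx !mul0mx !addr0.
  rewrite -scalemxAl mul_mx_scalar scalerA mulVf// scale1r.
  by rewrite -scalemxAl /C addrC subrK.
by rewrite det_mulmx det_lblock det_ublock !det1 det_scalar expr1 !mul1r.
Qed.

(** The shift (t / s) b is the conditional mean of the tail, which removes the cross terms. Instead
    of inverting [S] by blocks, the system S x = w is solved explicitly and w^T x is evaluated. *)
Lemma schur_inv_quadratic (t : R) (v : 'cV[R]_n) :
  let w : 'cV_(1 + n) := col_mx t%:M (v + (t / s) *: b) in
  (w^T *m invmx S *m w) ord0 ord0 = t ^+ 2 / s + (v^T *m invmx C *m v) ord0 ord0.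
Proof.
move=> w; set y := invmx C *m v.
have CU := sym_posdef_unit schur_sym_posdef.
have Cy : C *m y = v by rewrite mulKVmx.
set e := (b^T *m y) ord0 ord0.
have by_ : b^T *m y = e%:M by rewrite [LHS]mx11_scalar.
pose x : 'cV[R]_(1 + n) := col_mx (t / s - e / s)%:M y.
have Sx : S *m x = w.
  rewrite schur_block mul_block_col by_ -scalar_mxM -raddfD /=; congr col_mx.
    by congr (_%:M); field.
  rewrite -[drsubmx S](subrK (s^-1 *: (b *m b^T))) -/C mulmxDl Cy.
  rewrite -scalemxAl -mulmxA by_ !mul_mx_scalar addrCA; congr (_ + _).
  by rewrite scalerA -scalerDl; congr (_ *: _); field.
rewrite -mulmxA -[in X in _ *m (_ *m X)]Sx mulKmx ?sym_posdef_unit//.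
rewrite /w /x tr_col_mx mul_row_col tr_scalar_mx -scalar_mxM linearD/= mulmxDl.
have -> : ((t / s) *: b)^T = (t / s) *: b^T by rewrite linearZ.
have D11 (A B : 'M[R]_1) : (A + B) ord0 ord0 = A ord0 ord0 + B ord0 ord0 by rewrite mxE.
have M11 (u : R) : (u%:M : 'M[R]_1) ord0 ord0 = u by rewrite mxE mulr1n.
rewrite -scalemxAl by_ scale_scalar_mx !D11 !M11 /y mulmxA.
by field.
Qed.

End Schur.

(** The determinant is the product of the successive pivots. *)
Lemma sym_posdef_det_gt0 {R : realType} {n} (S : 'M[R]_n) : sym_posdef S -> 0 < \det S.
Proof.
elim: n S => [|n IH] S Sp; first by rewrite det_mx00.
rewrite (@schur_det R n S Sp) mulr_gt0//; first exact: (@schur_pivot_gt0 R n S Sp).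
by apply: IH; exact: (@schur_sym_posdef R n S Sp).
Qed.

(** * The law of a linear functional of a Gaussian vector *)

Section GaussLine.
Context {R : realType}.
Local Notation leb := (@lebesgue_measure R).
Local Notation phi := (@normal_pdf R 0 1).

Lemma gauss_density_ge0 n (S : 'M[R]_n) w : 0 <= gauss_density S w.
Proof. by rewrite mulr_ge0 ?invr_ge0 ?sqrtr_ge0 ?expR_ge0. Qed.

Lemma measurable_gauss_density n (S : 'M[R]_n) :
  measurable_fun [set: Rn R n] (gauss_density S : Rn R n -> R).
Proof.
apply: measurable_funM; first exact: measurable_cst.
apply: measurableT_comp => //; apply: measurable_funM; last exact: measurable_cst.
apply: measurableT_comp => //; under eq_fun do rewrite -mulmxA mxE.
apply: measurable_sum => i; apply: measurable_funM.
  by under eq_fun do rewrite mxE; exact: measurable_coord.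
apply: (measurableT_comp (measurable_coord n i)).
exact: (@measurable_mulmx _ _ (Rn R n)).
Qed.

(** Chain rule for densities: the marginal of the first coordinate times the conditional density of
    the tail, recentred at its conditional mean. *)
Lemma gauss_density_schur n (S : 'M[R]_n.+1) (t : R) (v : 'cV[R]_n) :
  sym_posdef S ->
  let s := S ord0 ord0 in
  let b : 'cV_n := dlsubmx (S : 'M[R]_(1 + n)) in
  let C := drsubmx (S : 'M[R]_(1 + n)) - s^-1 *: (b *m b^T) in
  gauss_density S (col_mx (const_mx t : 'cV_1) (v + (t / s) *: b)) =
  (Num.sqrt s)^-1 * phi ((Num.sqrt s)^-1 * t) * gauss_density C v.
Proof.
move=> Sp s b C.
have s0 : 0 < s := @schur_pivot_gt0 R n S Sp.
rewrite /gauss_density normal_pdf01E.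
have -> : const_mx t = t%:M :> 'cV_1 by apply/matrixP => i j; rewrite !mxE !ord1 eqxx.
rewrite (@schur_inv_quadratic R n S Sp) (@schur_det R n S Sp) -/s -/b -/C.
set q := (v^T *m _ *m v) ord0 ord0.
have -> : expR (- (t ^+ 2 / s + q) / 2) =
    expR (- ((Num.sqrt s)^-1 * t) ^+ 2 / 2) * expR (- q / 2).
  rewrite -expRD exprMn exprVn sqr_sqrtr ?ltW//; congr expR.
  by field; rewrite gt_eqF.
have -> : (pi *+ 2) ^+ n.+1 * (s * \det C) = s * (pi *+ 2) * ((pi *+ 2) ^+ n * \det C).
  by rewrite exprS mulrACA mulrA [pi *+ 2 * s]mulrC -!mulrA.
have pi2 : 0 <= (pi : R) *+ 2 by rewrite mulrn_wge0// pi_ge0.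
rewrite [Num.sqrt (_ * _ * _)]sqrtrM ?mulr_ge0 ?(ltW s0)// [Num.sqrt (s * _)]sqrtrM ?(ltW s0)//.
rewrite !invfM.
by ring.
Qed.

(* A linear functional of N(0, S) is N(0, a^T S a). Integrating out the last n
   variables first, they are Gaussian with covariance the Schur complement and
   mean (t / s) b; the outer integral is then a convolution on R. *)
Lemma gauss_line n (S : 'M[R]_n) (a : 'cV[R]_n) (G : R -> \bar R) :
  sym_posdef S -> measurable_fun [set: measurableTypeR R] G -> (forall t, (0 <= G t)%E) ->
  (lebint (fun w : 'cV[R]_n => G ((a^T *m w) ord0 ord0) * (gauss_density S w)%:E) =
   \int[leb]_z (G (Num.sqrt ((a^T *m S *m a) ord0 ord0) * z)%R * (phi z)%:E))%E.
Proof.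
elim: n S a G => [|n IH] S a G Sp mG G0.
  (* In dimension 0 the functional is 0 and the density is 1, so both sides are [G 0]. *)
  rewrite /= mulmx0 [in RHS]flatmx0 mulmx0 !mxE sqrtr0.
  under eq_integral do rewrite mul0r.
  rewrite ge0_integralZl//.
  - rewrite integral_normal_pdf /gauss_density expr0 mul1r det_mx00 sqrtr1 invr1.
    by rewrite mulmx0 mxE oppr0 mul0r expR0 mul1r.
  - by apply/measurable_EFinP; exact: measurable_pdf01.
  - by move=> z _; rewrite lee_fin normal_pdf_ge0.
pose s := S ord0 ord0.
pose b := dlsubmx (S : 'M[R]_(1 + n)) : 'cV_n.
pose C := drsubmx (S : 'M[R]_(1 + n)) - s^-1 *: (b *m b^T).
have Cp : sym_posdef C := @schur_sym_posdef R n S Sp.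
have s0 : 0 < s := @schur_pivot_gt0 R n S Sp.
pose sg := Num.sqrt s.
have sg0 : 0 < sg by rewrite sqrtr_gt0.
pose a1 := a ord0 ord0; pose a2 := dsubmx (a : 'cV_(1 + n)).
have aE : a = col_mx a1%:M a2.
  rewrite -[LHS](vsubmxK (a : 'cV_(1 + n))); congr (@col_mx _ 1 n _ _ _).
  by rewrite [LHS]mx11_scalar !mxE; congr (a _ _)%:M; exact: val_inj.
(* Given the first coordinate t, the functional is Gaussian with mean [c * t] and standard deviation
   [k]. *)
pose k := Num.sqrt ((a2^T *m C *m a2) ord0 ord0).
pose c := a1 + (a2^T *m b) ord0 ord0 / s.
have phi0 z : (0 <= (phi z)%:E)%E by rewrite lee_fin normal_pdf_ge0.
pose g (t : R) : \bar R :=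
  ((sg^-1)%:E * ((\int[leb]_z (G (c * (sg * t) + k * z)%R * (phi z)%:E)) * (phi t)%:E))%E.
have g0 t : (0 <= g t)%E.
  apply: mule_ge0; first by rewrite lee_fin invr_ge0 ltW.
  apply: mule_ge0 => //.
  by apply: integral_ge0 => z _; rewrite mule_ge0.
have mI : measurable_fun [set: measurableTypeR R]
    (fun t : measurableTypeR R => \int[leb]_z (G (c * (sg * t) + k * z)%R * (phi z)%:E))%E.
  apply: (@measurable_fun_fubini_tonelli_F _ _ (measurableTypeR R)
    (measurableTypeR R) R leb
    (fun p => G (c * (sg * p.1) + k * p.2)%R * (phi p.2)%:E)%E) => [|p].
    apply: emeasurable_funM; last first.
      by apply/measurable_EFinP; exact: (measurableT_comp measurable_pdf01 measurable_snd).
    apply: (measurableT_comp mG); apply: measurable_funD.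
      apply: (measurableT_comp (mulrl_measurable c)).
      exact: (measurableT_comp (mulrl_measurable sg) measurable_fst).
    exact: (measurableT_comp (mulrl_measurable k) measurable_snd).
  by rewrite mule_ge0.
have mg : measurable_fun [set: measurableTypeR R] g.
  apply: emeasurable_funM; first exact: measurable_cst.
  apply: emeasurable_funM => //.
  by apply/measurable_EFinP; exact: measurable_pdf01.
rewrite [LHS]/=.
(* Rescaling by [sg] makes the first coordinate standard; the Jacobian cancels the prefactor of
   [g]. *)
transitivity (\int[leb]_t g (sg^-1 * t + 0)%R)%E; last first.
  rewrite (@ge0_integral_affine _ _ _ g) ?invr_eq0 ?gt_eqF//.
  rewrite /g ge0_integralZl//; last 3 first.
  - by apply: emeasurable_funM => //; apply/measurable_EFinP; exact: measurable_pdf01.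
  - move=> t _; rewrite mule_ge0//.
    by apply: integral_ge0 => z _; rewrite mule_ge0.
  - by rewrite lee_fin invr_ge0 ltW.
  rewrite muleA -EFinM gtr0_norm ?invr_gt0// invrK divff ?gt_eqF// mul1e.
  transitivity (\int[leb]_t ((\int[leb]_z
      (G (c * sg * t + k * z)%R * (phi z)%:E)) * (phi t)%:E))%E.
    apply: eq_integral => t _; congr (_ * _)%E.
    by apply: eq_integral => z _; rewrite mulrA.
  rewrite (normal_convolution G mG G0).
  apply: eq_integral => z _; congr (G (Num.sqrt _ * _)%R * _)%E.
  rewrite exprMn !sqr_sqrtr ?(ltW s0)//; last exact: sym_posdef_ge0.
  (* The variances add up by the completed square at [a]: a^T S a = k^2 + c^2 s. *)
  by rewrite [in RHS]aE (@schur_quadratic R n S Sp).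
apply: eq_integral => t _; rewrite addr0.
pose F (w : Rn R n.+1) : \bar R := (G ((a^T *m w) ord0 ord0) * (gauss_density S w)%:E)%E.
have mF : measurable_fun [set: Rn R n.+1] F.
  apply: emeasurable_funM.
    apply: (measurableT_comp mG).
    apply: (measurableT_comp (measurable_coord 1 ord0)).
    exact: (@measurable_mulmx _ _ (Rn R n.+1)).
  by apply/measurable_EFinP; exact: measurable_gauss_density.
have F0 w : (0 <= F w)%E by rewrite mule_ge0// lee_fin gauss_density_ge0.
(* Recentring the tail at its conditional mean makes the density factor. *)
rewrite -(@lebint_translate R n ((t / s) *: b)
  (fun v => F (col_mx (const_mx t : 'cV_1) v)))//; last exact: measurable_section.
transitivity (lebint (fun v : 'cV[R]_n =>
   (sg^-1 * phi (sg^-1 * t))%:E *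
   (G ((c * t)%R + (a2^T *m v)%R ord0 ord0)%R * (gauss_density C v)%:E))%E).
  apply: eq_lebint => v; rewrite /F gauss_density_schur//.
  rewrite [RHS]muleCA EFinM; congr (G _ * _)%E.
  rewrite [in LHS]aE (@tr_col_mx _ 1 n) (@mul_row_col _ _ 1 n).
  have -> : const_mx t = t%:M :> 'cV_1 by apply/matrixP => i j; rewrite !mxE !ord1 eqxx.
  rewrite tr_scalar_mx -scalar_mxM mulmxDr -scalemxAr.
  rewrite [LHS]mxE [X in X + _ = _]mxE [X in _ + X = _]mxE [X in _ + (_ + X)]mxE.
  by rewrite eqxx mulr1n /c; field; rewrite gt_eqF.
pose G' u := G (1 * u + c * t).
have mG' : measurable_fun [set: measurableTypeR R] G'.
  by apply: (measurableT_comp mG); exact: measurable_affine.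
have G'0 u : (0 <= G' u)%E by exact: G0.
have GG' u : G (c * t + u) = G' u by rewrite /G' mul1r addrC.
under eq_lebint do rewrite GG'.
rewrite lebintZl; last 3 first.
- by rewrite mulr_ge0 ?invr_ge0 ?normal_pdf_ge0// ltW.
- apply: emeasurable_funM.
    apply: (measurableT_comp mG').
    apply: (measurableT_comp (measurable_coord 1 ord0)).
    exact: (@measurable_mulmx _ _ (Rn R n)).
  by apply/measurable_EFinP; exact: measurable_gauss_density.
- by move=> v; rewrite mule_ge0// lee_fin gauss_density_ge0.
rewrite IH// /g EFinM -muleA [X in (_ * X)%E]muleC; congr (_ * (_ * _))%E.
apply: eq_integral => z _; rewrite -GG' -/k; congr (G (_ * _ + _)%R * _)%E.
by rewrite mulVKf// gt_eqF.
Qed.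

End GaussLine.

(** * Spectral norms and the credible set *)

Section Norms.
#[local] Set Implicit Arguments.
#[local] Unset Strict Implicit.
Context {R : realType}.

Lemma enorm_ge0 n (v : 'cV[R]_n) : 0 <= enorm v.
Proof. exact: sqrtr_ge0. Qed.

Lemma enorm_sqr n (v : 'cV[R]_n) : enorm v ^+ 2 = (v^T *m v) ord0 ord0.
Proof.
rewrite sqr_sqrtr; last by rewrite sumr_ge0// => i _; exact: sqr_ge0.
by rewrite mxE; apply: eq_bigr => i _; rewrite mxE expr2.
Qed.

Lemma enorm_eq0 n (v : 'cV[R]_n) : enorm v = 0 -> v = 0.
Proof.
move/eqP; rewrite sqrtr_eq0 => v0.
have /eqP : \sum_i v i ord0 ^+ 2 = 0.
  by apply/eqP; rewrite eq_le v0/= sumr_ge0// => i _; exact: sqr_ge0.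
rewrite psumr_eq0; last by move=> i _; exact: sqr_ge0.
move=> /allP h; apply/matrixP => i j; rewrite ord1 mxE.
by have := h i (mem_index_enum _); rewrite sqrf_eq0 => /eqP.
Qed.

Lemma enorm0 n : enorm (0 : 'cV[R]_n) = 0.
Proof.
by apply/eqP; rewrite -sqrf_eq0 enorm_sqr mulmx0 mxE.
Qed.

Lemma enormZ n (c : R) (v : 'cV[R]_n) : enorm (c *: v) = `|c| * enorm v.
Proof.
rewrite /enorm -sqrtr_sqr -sqrtrM ?sqr_ge0// mulr_sumr; congr Num.sqrt.
by apply: eq_bigr => i _; rewrite mxE exprMn.
Qed.

Lemma sym_posdef1 n : sym_posdef (1%:M : 'M[R]_n).
Proof.
split=> [|v v0]; first exact: trmx1.
rewrite mulmx1 -enorm_sqr exprn_gt0// lt_neqAle enorm_ge0 andbT eq_sym.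
by apply: contra v0 => /eqP/enorm_eq0 ->.
Qed.

Lemma sym_posdef_bilC n (A : 'M[R]_n) (x y : 'cV[R]_n) : sym_posdef A ->
  (x^T *m A *m y) ord0 ord0 = (y^T *m A *m x) ord0 ord0.
Proof.
move=> Ap; rewrite -[in RHS](proj1 Ap) -mulmxA -[x in RHS]trmxK -!trmx_mul.
by rewrite [RHS]mxE.
Qed.

Lemma cauchy_schwarz_form n (A : 'M[R]_n) (x y : 'cV[R]_n) : sym_posdef A ->
  ((x^T *m A *m y) ord0 ord0) ^+ 2 <=
  (x^T *m A *m x) ord0 ord0 * (y^T *m A *m y) ord0 ord0.
Proof.
move=> Ap; have [->|y0] := eqVneq y 0.
  by rewrite mulmx0 [X in X ^+ 2]mxE expr0n/= mulr_ge0 ?sym_posdef_ge0.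
set b := (x^T *m A *m y) ord0 ord0; set q := (y^T *m A *m y) ord0 ord0.
have q0 : 0 < q := (proj2 Ap) _ y0.
(* (b / q) y is the projection of x onto y for the form [A]. *)
have := sym_posdef_ge0 (x - (b / q) *: y) Ap.
have -> : (x - (b / q) *: y)^T = x^T - (b / q) *: y^T by rewrite linearB linearZ.
rewrite !mulmxBl !mulmxBr -!scalemxAr -!scalemxAl.
have M11 (u v : 'M[R]_1) : (u - v) ord0 ord0 = u ord0 ord0 - v ord0 ord0 by rewrite !mxE.
have Z11 k (u : 'M[R]_1) : (k *: u) ord0 ord0 = k * u ord0 ord0 by rewrite mxE.
rewrite !M11 !Z11 (sym_posdef_bilC y x)// -/b -/q.
set a := (x^T *m A *m x) ord0 ord0.
rewrite (_ : _ - _ - _ = a - b ^+ 2 / q); last by field; rewrite gt_eqF.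
by rewrite subr_ge0 ler_pdivrMr.
Qed.

Lemma cauchy_schwarz n (x y : 'cV[R]_n) :
  ((x^T *m y) ord0 ord0) ^+ 2 <= enorm x ^+ 2 * enorm y ^+ 2.
Proof.
have := cauchy_schwarz_form x y (sym_posdef1 n).
by rewrite !mulmx1 !enorm_sqr.
Qed.

(** The [sup] in [specnorm] bounds its set only once the set is known to be bounded. Entries of a
    vector in the unit ball are at most 1 in absolute value, hence the absolute row sums. *)
Lemma specnorm_has_ubound p q (M : 'M[R]_(p, q)) :
  has_ubound [set enorm (M *m x) | x in [set x : 'cV[R]_q | enorm x <= 1]].
Proof.
exists (Num.sqrt (\sum_i (\sum_j `|M i j|) ^+ 2)) => _ [y y1 <-].
apply: ler_wsqrtr; apply: ler_sum => i _.
rewrite -[leLHS]real_normK ?num_real// ler_sqr ?nnegrE ?sumr_ge0//.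
rewrite mxE; apply: le_trans (ler_norm_sum _ _ _) _; apply: ler_sum => j _.
rewrite normrM ler_piMr//; apply: le_trans y1.
rewrite -sqrtr_sqr; apply: ler_wsqrtr.
by rewrite (bigD1 j)//= lerDl sumr_ge0// => k _; exact: sqr_ge0.
Qed.

Lemma specnorm_ge0 p q (M : 'M[R]_(p, q)) : 0 <= specnorm M.
Proof.
apply: (ub_le_sup (specnorm_has_ubound M)).
by exists 0; rewrite /= ?mulmx0 enorm0 ?ler01.
Qed.

Lemma enorm_mulmx_specnorm p q (M : 'M[R]_(p, q)) (x : 'cV[R]_q) :
  enorm (M *m x) <= specnorm M * enorm x.
Proof.
have [->|x0] := eqVneq x 0; first by rewrite mulmx0 !enorm0 mulr0.
have nx0 : 0 < enorm x.
  rewrite lt_neqAle enorm_ge0 andbT eq_sym.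
  by apply: contra x0 => /eqP/enorm_eq0 ->.
rewrite -ler_pdivrMr//.
rewrite (_ : _ / _ = enorm (M *m ((enorm x)^-1 *: x))); last first.
  by rewrite -scalemxAr enormZ ger0_norm ?invr_ge0 ?enorm_ge0// mulrC.
apply: (ub_le_sup (specnorm_has_ubound M)).
exists ((enorm x)^-1 *: x) => //=.
by rewrite enormZ ger0_norm ?invr_ge0 ?enorm_ge0// mulVf// gt_eqF.
Qed.

Lemma quadratic_specnorm n (A : 'M[R]_n) (v : 'cV[R]_n) :
  (v^T *m A *m v) ord0 ord0 <= specnorm A * enorm v ^+ 2.
Proof.
rewrite -mulmxA; apply: le_trans (ler_norm _) _.
apply: le_trans (_ : enorm v * enorm (A *m v) <= _).
  rewrite -ler_sqr ?nnegrE ?mulr_ge0 ?enorm_ge0// real_normK ?num_real//.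
  by rewrite exprMn cauchy_schwarz.
by rewrite expr2 mulrCA ler_wpM2l ?enorm_ge0// enorm_mulmx_specnorm.
Qed.

Lemma sym_posdef_inv n (A : 'M[R]_n) : sym_posdef A -> sym_posdef (invmx A).
Proof.
move=> Ap; have AU := sym_posdef_unit Ap.
have AT : (invmx A)^T = invmx A by rewrite trmx_inv (proj1 Ap).
split=> // v v0.
have := (proj2 Ap) (invmx A *m v).
rewrite trmx_mul AT -!mulmxA mulKVmx// mulmxA; apply.
apply: contra v0 => /eqP Av; by rewrite -(mulKVmx AU v) Av mulmx0.
Qed.

Lemma enorm_le_specnorm_inv n (A : 'M[R]_n) (d : 'cV[R]_n) : sym_posdef A ->
  enorm d ^+ 2 <= specnorm A * (d^T *m invmx A *m d) ord0 ord0.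
Proof.
move=> Ap; have AU := sym_posdef_unit Ap; have Ip := sym_posdef_inv Ap.
have [->|d0] := eqVneq d 0.
  by rewrite enorm0 expr0n/= mulr_ge0 ?specnorm_ge0 ?sym_posdef_ge0.
have nd0 : 0 < enorm d ^+ 2.
  by rewrite enorm_sqr; have := (proj2 (sym_posdef1 n)) d d0; rewrite mulmx1.
rewrite -(ler_pM2l nd0) -expr2.
(* For the pair d, A d the mixed term is |d|^2. Its square is the left side of the goal after the
   multiplication by |d|^2, and d^T A d is at most ||A|| |d|^2; this avoids eigenvalues. *)
have := cauchy_schwarz_form d (A *m d) Ip.
rewrite -mulmxA mulKmx// -enorm_sqr => /le_trans; apply.
rewrite trmx_mul (proj1 Ap) -(mulmxA (d^T *m A)) mulKmx//.
rewrite mulrCA [leRHS]mulrA [leRHS]mulrC ler_wpM2l ?sym_posdef_ge0//.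
exact: quadratic_specnorm.
Qed.

End Norms.

(** * Kronecker products, the posterior covariance and the deviation bound *)

Section Kron.
#[local] Set Implicit Arguments.
#[local] Unset Strict Implicit.
Context {R : realType}.

Lemma kronE p q r s (A : 'M[R]_(p, q)) (B : 'M[R]_(r, s)) i k j l :
  kron A B (mxvec_index i k) (mxvec_index j l) = A i j * B k l.
Proof.
have E p' r' (x : 'I_p') (y : 'I_r') : kron_idx (mxvec_index x y) = (x, y).
  by rewrite /kron_idx /mxvec_index cast_ordK enum_rankK.
by rewrite mxE !E.
Qed.

Lemma sum_mxvec_index p r (F : 'I_(p * r) -> R) :
  \sum_k F k = \sum_i \sum_j F (mxvec_index i j).
Proof.
rewrite pair_bigA (reindex _ (curry_mxvec_bij p r)).
by apply: eq_bigr => -[].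
Qed.

Lemma trmx_kron p q r s (A : 'M[R]_(p, q)) (B : 'M[R]_(r, s)) :
  (kron A B)^T = kron A^T B^T.
Proof. by apply/matrixP => i j; rewrite !mxE. Qed.

(** Let V be the m x n matrix whose columns are the blocks of v. The form is the sum of the
    quadratic forms of [A] at the rows of B V, which are the vectors [Y k]. *)
Lemma kron_gram_ge0 n m N (A : 'M[R]_n) (B : 'M[R]_(N, m)) (v : 'cV[R]_(n * m)) :
  sym_posdef A -> 0 <= (v^T *m kron A (B^T *m B) *m v) ord0 ord0.
Proof.
move=> Ap.
pose Y k : 'cV[R]_n := \col_i \sum_a v (mxvec_index i a) ord0 * B k a.
rewrite (_ : _ ord0 ord0 = \sum_k ((Y k)^T *m A *m Y k) ord0 ord0); last first.
  rewrite mxE sum_mxvec_index.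
  under eq_bigr do under eq_bigr do rewrite mxE sum_mxvec_index.
  under [RHS]eq_bigr do rewrite mxE.
  rewrite [RHS]exchange_big/=; apply: eq_bigr => j _.
  (* For fixed j both sides expand into the same fourfold sum, up to the order of summation. *)
  transitivity (\sum_l \sum_i \sum_a \sum_k
     (v (mxvec_index i a) ord0 * B k a * A i j * (v (mxvec_index j l) ord0 * B k l))).
    apply: eq_bigr => l _; rewrite mulr_suml; apply: eq_bigr => i _.
    rewrite mulr_suml; apply: eq_bigr => a _.
    rewrite kronE !mxE !mulr_sumr mulr_suml; apply: eq_bigr => k _.
    by rewrite !mxE; ring.
  under [RHS]eq_bigr do rewrite mxE.
  transitivity (\sum_k \sum_l \sum_i \sum_a
     (v (mxvec_index i a) ord0 * B k a * A i j * (v (mxvec_index j l) ord0 * B k l))).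
    rewrite [RHS]exchange_big/=; apply: eq_bigr => l _.
    rewrite [RHS]exchange_big/=; apply: eq_bigr => i _.
    by rewrite [RHS]exchange_big.
  apply: eq_bigr => k _; rewrite mxE mulr_sumr; apply: eq_bigr => l _.
  rewrite mulr_suml; apply: eq_bigr => i _.
  by rewrite !mxE !mulr_suml.
by rewrite sumr_ge0// => k _; exact: sym_posdef_ge0.
Qed.

(** The data term contributes a nonnegative form; strict positivity comes from the prior
    precision. *)
Lemma SigmaN_sym_posdef n m N (U : Type) (f : 'cV[R]_n -> U -> 'cV[R]_m)
  (S : 'M[R]_n) (S0 : 'M[R]_(n * m)) (xs : 'I_N -> 'cV[R]_n) (us : 'I_N -> U) :
  sym_posdef S -> sym_posdef S0 -> sym_posdef (SigmaN f S S0 xs us).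
Proof.
move=> Sp S0p; apply: sym_posdef_inv.
have [ST _] := sym_posdef_inv Sp.
have [S0T S0pos] := sym_posdef_inv S0p.
split=> [|v v0].
  by rewrite linearD/= S0T trmx_kron ST trmx_mul trmxK.
rewrite mulmxDr mulmxDl mxE ltr_pwDl ?S0pos//.
by apply: kron_gram_ge0; exact: sym_posdef_inv.
Qed.

(** This is the squared Frobenius norm, in the form suited to a Cauchy-Schwarz bound column by
    column. *)
Lemma enorm_thetabar m n (D : 'M[R]_(m, n)) :
  enorm (thetabar D) ^+ 2 = \sum_j enorm (col j D) ^+ 2.
Proof.
rewrite enorm_sqr mxE sum_mxvec_index; apply: eq_bigr => j _.
rewrite enorm_sqr mxE; apply: eq_bigr => k _.
by rewrite !mxE !mxvecE !mxE.
Qed.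

Lemma enorm_trmul_le m n (D : 'M[R]_(m, n)) (x : 'cV[R]_m) :
  enorm (D^T *m x) ^+ 2 <= enorm (thetabar D) ^+ 2 * enorm x ^+ 2.
Proof.
rewrite enorm_thetabar enorm_sqr mxE mulr_suml; apply: ler_sum => j _.
rewrite mxE -expr2 (_ : (D^T *m x) j ord0 = ((col j D)^T *m x) ord0 ord0).
  exact: cauchy_schwarz.
by rewrite !mxE; apply: eq_bigr => k _; rewrite !mxE.
Qed.

Lemma credible_deviation n m N (U : Type) (f : 'cV[R]_n -> U -> 'cV[R]_m)
  (S : 'M[R]_n) (mu0 : 'cV[R]_(n * m)) (S0 : 'M[R]_(n * m))
  (xs : 'I_N -> 'cV[R]_n) (us : 'I_N -> U) (xps : 'I_N -> 'cV[R]_n)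
  (alpha : R) (th : 'M[R]_(m, n)) (y : 'cV[R]_m) :
  sym_posdef S -> sym_posdef S0 ->
  let SN := SigmaN f S S0 xs us in
  let thh := thetahat f S mu0 S0 xs us xps in
  credible_set (muN f S mu0 S0 xs us xps) SN alpha th ->
  let g := (th - thh)^T *m y in
  (g^T *m invmx S *m g) ord0 ord0 <=
  specnorm (invmx S) * specnorm SN * n%:R * chi2_quantile n (1 - alpha) * enorm y ^+ 2.
Proof.
move=> Sp S0p SN thh; rewrite /credible_set/=.
(* Vectorising [thetahat] gives back [muN], so by linearity the credible set constrains the
   vectorised difference [th - thh]. *)
have -> : muN f S mu0 S0 xs us xps = thetabar thh.
  by rewrite /thetabar /thh /thetahat trmxK vec_mxK trmxK.
have -> : thetabar th - thetabar thh = thetabar (th - thh).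
  by rewrite /thetabar !linearB.
move=> cr.
have SNp : sym_posdef SN by exact: SigmaN_sym_posdef.
apply: le_trans (quadratic_specnorm _ _) _.
rewrite -!mulrA ler_wpM2l ?specnorm_ge0//.
apply: le_trans (enorm_trmul_le _ _) _; rewrite !mulrA.
rewrite !ler_wpM2r ?enorm_ge0//.
apply: le_trans (enorm_le_specnorm_inv _ SNp) _.
by rewrite -mulrA ler_wpM2l ?specnorm_ge0.
Qed.

End Kron.

(** * The coupling kernel *)

Section ImageMeasure.
Context {R : realType} {d : measure_display} {T : measurableType d} {n : nat}.
Variables (psi : Rn R n -> T) (k : Rn R n -> R).
Hypothesis mpsi : measurable_fun [set: Rn R n] psi.
Hypothesis mk : measurable_fun [set: Rn R n] k.
Hypothesis k0 : forall w, 0 <= k w.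

Lemma measurable_indic_density (A : set T) : measurable A ->
  measurable_fun [set: Rn R n] (fun w => (\1_A (psi w) * k w)%:E).
Proof.
move=> mA; apply/measurable_EFinP; apply: measurable_funM => //.
exact: (measurableT_comp (measurable_indic mA) mpsi).
Qed.

Lemma indic_density_ge0 (A : set T) w : (0 <= (\1_A (psi w) * k w)%:E)%E.
Proof. by rewrite lee_fin mulr_ge0. Qed.

(** The image under [psi] of the measure with density [k], written so that [vker] is an instance of
    it by conversion. *)
Definition density_image (A : set T) : \bar R :=
  lebint (fun w : 'cV[R]_n => (\1_A (psi w) * k w)%:E).

Lemma density_image0 : density_image set0 = 0%E.
Proof.
rewrite -[RHS](@lebint0 R n); apply: eq_lebint => w.
by rewrite indic0 mul0r.
Qed.

Lemma density_image_ge0 A : (0 <= density_image A)%E.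
Proof. by apply: lebint_ge0 => w; exact: indic_density_ge0. Qed.

Lemma density_image_sigma_additive : semi_sigma_additive density_image.
Proof.
move=> F mF tF mUF.
have -> : density_image (\bigcup_i F i) = (\sum_(0 <= i <oo) density_image (F i))%E.
  rewrite -(@lebint_nneseries R n (fun i w => (\1_(F i) (psi w) * k w)%:E)).
  - apply: eq_lebint => w.
    (* Reading the indicator as a Dirac mass at [psi w] turns the disjoint union into a pointwise
       series. *)
    transitivity (\d_(psi w) (\bigcup_i F i) * (k w)%:E)%E.
      by rewrite diracE EFinM indicE.
    rewrite measure_semi_bigcup// muleC -nneseriesZl//.
    by apply: eq_eseriesr => i _; rewrite /= diracE EFinM indicE muleC.
  - by move=> i; exact: measurable_indic_density.
  - by move=> i w; exact: indic_density_ge0.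
by apply: is_cvg_nneseries => i _ _; exact: density_image_ge0.
Qed.

Definition density_image_measure : {measure set T -> \bar R} :=
  HB.pack density_image (isMeasure.Build _ _ _ density_image
    density_image0 density_image_ge0 density_image_sigma_additive).

End ImageMeasure.

(** * Half-lines under the standard normal law *)

Section NormalCdf.
Context {R : realType}.
Local Notation leb := (@lebesgue_measure R).
Local Notation phi := (@normal_pdf R 0 1).

Lemma normal_integral_indic (A : set (measurableTypeR R)) : measurable A ->
  (\int[leb]_z ((\1_A z)%:E * (phi z)%:E) = normal_prob 0 1 A)%E.
Proof.
move=> mA; rewrite /normal_prob [RHS]integral_mkcond; apply: eq_integral => z _.
by rewrite patchE indicE; case: ifP => _; rewrite ?mul1e ?mul0e.
Qed.

Lemma normal_cdfE (t : R) : (normal_cdf t)%:E = normal_prob 0 1 `]-oo, t].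
Proof. by rewrite /normal_cdf fineK// fin_num_measure. Qed.

Lemma normal_cdf_le : {homo @normal_cdf R : s t / s <= t}.
Proof.
move=> s t st; rewrite -lee_fin !normal_cdfE; apply: le_measure; rewrite ?inE//.
by apply: subset_itvl; rewrite bnd_simp.
Qed.

Lemma normal_prob_open (t : R) : normal_prob 0 1 `]-oo, t[ = (normal_cdf t)%:E.
Proof.
rewrite normal_cdfE /normal_prob integral_itv_bndo_bndc//.
by apply/measurable_EFinP; apply: measurable_funTS; exact: measurable_pdf01.
Qed.

(** Reflection at 0 preserves the standard normal law and maps the half-line to ]-oo, -t]. *)
Lemma normal_prob_ge (t : R) : normal_prob 0 1 `[t, +oo[ = (normal_cdf (- t))%:E.
Proof.
rewrite normal_cdfE -!normal_integral_indic//.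
have mG : measurable_fun [set: measurableTypeR R] (fun z => (\1_(`[t, +oo[) z)%:E : \bar R).
  by apply/measurable_EFinP; exact: measurable_indic.
transitivity (\int[leb]_z ((\1_(`[t, +oo[) (1 * z))%:E * (phi z)%:E))%E.
  by apply: eq_integral => z _; rewrite mul1r.
rewrite -(@normal_integral_opp R _ mG) => [|z]; last by rewrite lee_fin.
apply: eq_integral => z _; rewrite !indicE; congr ((nat_of_bool _)%:R%:E * _)%E.
by apply/idP/idP; rewrite !inE/= !in_itv/= ?andbT mulN1r; lra.
Qed.

End NormalCdf.

(** * The overlap of two translated Gaussian densities *)

Section Overlap.
Context {R : realType} {n : nat}.
Variables (S : 'M[R]_n) (g : 'cV[R]_n).
Hypothesis Sp : sym_posdef S.
Local Notation leb := (@lebesgue_measure R).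
Local Notation phi := (@normal_pdf R 0 1).

Lemma lebint_gauss_density : lebint (fun w : 'cV[R]_n => (gauss_density S w)%:E) = 1%E.
Proof.
have := @gauss_line R n S 0 (fun=> 1%E) Sp (measurable_cst _) (fun=> lee01).
under eq_lebint do rewrite mul1e.
move=> ->; under eq_integral do rewrite mul1e.
exact: integral_normal_pdf.
Qed.

Let q := (g^T *m invmx S *m g) ord0 ord0.
Let a := invmx S *m g.

(* Up to the common constant the densities are exp(-|.|^2/2), so the minimum is
   phi(w + g) on one side of the bisecting hyperplane and phi(w) on the other. *)
Lemma min_gauss_density w :
  Num.min (gauss_density S w) (gauss_density S (w + g)) =
  \1_(`[q / 2, +oo[) ((a^T *m (w + g)) ord0 ord0) * gauss_density S (w + g) +
  \1_(`]-oo, - (q / 2)[) ((a^T *m w) ord0 ord0) * gauss_density S w.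
Proof.
have Ip := sym_posdef_inv Sp.
have aT : a^T = g^T *m invmx S by rewrite trmx_mul (proj1 Ip).
set e := (a^T *m w) ord0 ord0.
have eg : (a^T *m (w + g)) ord0 ord0 = e + q.
  by rewrite mulmxDr [LHS]mxE /q -aT.
have qw : ((w + g)^T *m invmx S *m (w + g)) ord0 ord0 =
    (w^T *m invmx S *m w) ord0 ord0 + (e *+ 2 + q).
  have D11 (A B : 'M[R]_1) : (A + B) ord0 ord0 = A ord0 ord0 + B ord0 ord0 by rewrite mxE.
  have -> : (w + g)^T = w^T + g^T by rewrite linearD.
  rewrite !mulmxDl !mulmxDr !D11 (sym_posdef_bilC w g Ip) /e aT -/q.
  by ring.
have dE : (gauss_density S (w + g) <= gauss_density S w) = (- (q / 2) <= e).
  rewrite /gauss_density ler_pM2l; last first.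
    by rewrite invr_gt0 sqrtr_gt0 mulr_gt0 ?sym_posdef_det_gt0// exprn_gt0// mulrn_wgt0// pi_gt0.
  rewrite ler_expR qw; apply/idP/idP; lra.
rewrite eg !indicE !mem_setE !in_itv/= andbT.
(* The first indicator is evaluated at w + g so that its whole term is a translate by g; seen from
   w, the two conditions are complementary. *)
have -> : (q / 2 <= e + q) = (- (q / 2) <= e) by apply/idP/idP; lra.
rewrite [e < _]ltNge -dE; by case: leP => h; rewrite mul1r mul0r ?addr0 ?add0r.
Qed.

(** After standardisation the two terms live on c z >= c^2 / 2 and c z < - c^2 / 2. For c > 0 these
    are z >= c / 2 and z < - c / 2, each of mass cdf(- c / 2). *)
Lemma overlap_ge :
  ((2 * normal_cdf (- (Num.sqrt q / 2)))%:E <=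
   lebint (fun w : 'cV[R]_n => (Num.min (gauss_density S w) (gauss_density S (w + g)))%:E))%E.
Proof.
have Ip := sym_posdef_inv Sp.
have SU := sym_posdef_unit Sp.
set c := Num.sqrt q.
have c0 : 0 <= c by exact: sqrtr_ge0.
have cq : c ^+ 2 = q by rewrite sqr_sqrtr// sym_posdef_ge0.
have aSa : (a^T *m S *m a) ord0 ord0 = q.
  by rewrite -mulmxA /a mulKVmx// trmx_mul (proj1 Ip).
pose I1 : R -> \bar R := fun z => (\1_(`[q / 2, +oo[) z)%:E.
pose I2 : R -> \bar R := fun z => (\1_(`]-oo, - (q / 2)[) z)%:E.
have mI1 : measurable_fun [set: measurableTypeR R] I1.
  by apply/measurable_EFinP; exact: measurable_indic.
have mI2 : measurable_fun [set: measurableTypeR R] I2.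
  by apply/measurable_EFinP; exact: measurable_indic.
have I10 z : (0 <= I1 z)%E by rewrite lee_fin.
have I20 z : (0 <= I2 z)%E by rewrite lee_fin.
have mline (I : R -> \bar R) : measurable_fun [set: measurableTypeR R] I ->
    measurable_fun [set: Rn R n]
      (fun w : Rn R n => (I ((a^T *m w)%R ord0 ord0) * (gauss_density S w)%:E)%E).
  move=> mI; apply: emeasurable_funM; last first.
    by apply/measurable_EFinP; exact: measurable_gauss_density.
  apply: (measurableT_comp mI); apply: (measurableT_comp (measurable_coord 1 ord0)).
  exact: (@measurable_mulmx _ _ (Rn R n)).
have line0 (I : R -> \bar R) w : (forall z, 0 <= I z)%E ->
    (0 <= I ((a^T *m w)%R ord0 ord0) * (gauss_density S w)%:E)%E.
  by move=> I0; rewrite mule_ge0// lee_fin gauss_density_ge0.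
have phi0 z : (0 <= (phi z)%:E)%E by rewrite lee_fin normal_pdf_ge0.
have mphi (I : R -> \bar R) : measurable_fun [set: measurableTypeR R] I ->
   measurable_fun [set: measurableTypeR R] (fun z => I z * (phi z)%:E)%E.
  move=> mI; apply: emeasurable_funM => //.
  by apply/measurable_EFinP; exact: measurable_pdf01.
have -> : lebint (fun w : 'cV[R]_n =>
      (Num.min (gauss_density S w) (gauss_density S (w + g)))%:E) =
    (\int[leb]_z (I1 (c * z)%R * (phi z)%:E + I2 (c * z)%R * (phi z)%:E))%E.
  rewrite ge0_integralD//; last 4 first.
  - by move=> z _; rewrite mule_ge0.
  - by apply: mphi; exact: (measurableT_comp mI1 (mulrl_measurable c)).
  - by move=> z _; rewrite mule_ge0.
  - by apply: mphi; exact: (measurableT_comp mI2 (mulrl_measurable c)).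
  rewrite /c -aSa -(@gauss_line R n S a I1)// -(@gauss_line R n S a I2)//.
  (* The translation by g restores the argument w + g of the first term. *)
  rewrite -(@lebint_translate R n g _ (mline _ mI1)); last by move=> w; exact: line0.
  rewrite -lebintD//.
  - by apply: eq_lebint => w; rewrite min_gauss_density EFinD !EFinM.
  - pose add_g (w : Rn R n) : Rn R n := w + g.
    apply: (@measurableT_comp _ _ _ _ _ _ _ _ add_g (mline _ mI1)).
    by apply: measurable_addmx => //; exact: measurable_cst.
  - exact: mline.
  - by move=> w; exact: line0.
  - by move=> w; exact: line0.
have -> : (2 * normal_cdf (- (c / 2)))%:E =
    (\int[leb]_z ((\1_(`[(c / 2)%R, +oo[) z)%:E * (phi z)%:E +
                 (\1_(`]-oo, (- (c / 2))%R[) z)%:E * (phi z)%:E))%E.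
  rewrite ge0_integralD//; last 4 first.
  - by move=> z _; rewrite mule_ge0// lee_fin.
  - by apply: mphi; apply/measurable_EFinP; exact: measurable_indic.
  - by move=> z _; rewrite mule_ge0// lee_fin.
  - by apply: mphi; apply/measurable_EFinP; exact: measurable_indic.
  rewrite !normal_integral_indic// normal_prob_ge normal_prob_open -EFinD.
  by rewrite mulr_natl mulr2n.
apply: ge0_le_integral => //.
- by move=> z _; rewrite adde_ge0// mule_ge0// lee_fin.
- by apply: emeasurable_funD; apply: mphi;
    apply/measurable_EFinP; exact: measurable_indic.
- apply: emeasurable_funD; apply: mphi.
    exact: (measurableT_comp mI1 (mulrl_measurable c)).
  exact: (measurableT_comp mI2 (mulrl_measurable c)).
move=> z _; rewrite -!ge0_muleDl ?lee_fin//.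
apply: ler_wpM2r; first exact: normal_pdf_ge0.
rewrite !indicE !mem_setE !in_itv/= !andbT -cq -!natrD ler_nat.
(* For c = 0 there is no division by c: one scaled indicator is constantly 1 and the other 0, while
   the unscaled half-lines at 0 partition the line, so both sums are 1. *)
have [cE|cn0] := eqVneq c 0.
  by rewrite cE expr0n/= !mul0r oppr0 lexx ltxx addn0 ltNge addnC addn_negb.
have cgt0 : 0 < c by rewrite lt_neqAle eq_sym cn0.
have -> : (c ^+ 2 / 2 <= c * z) = (c / 2 <= z) by rewrite expr2 -mulrA ler_pM2l.
rewrite expr2 -mulrA -[- (c * (c / 2))]mulrN.
by rewrite ltr_pM2l.
Qed.

End Overlap.

(** * The kernel v at related states, where both states are equal *)

Section CouplingKernel.
Context {R : realType} {n m : nat} {U : Type}.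
Variables (f : 'cV[R]_n -> U -> 'cV[R]_m) (thh th : 'M[R]_(m, n)) (S : 'M[R]_n).
Variables (x : 'cV[R]_n) (u : U).
Let y := f x u.
Let gam := (th - thh)^T *m y.
Let psi (w : Rn R n) : (Rn R n * Rn R n)%type :=
  (thh^T *m y + gam + w, th^T *m y + w).
Let k (w : Rn R n) : R := Num.min (gauss_density S w) (gauss_density S (w + gam)).

(** The offset [gam] exactly compensates the model mismatch, so [psi] takes values in the diagonal
    and v is concentrated on [Rrel]. *)
Lemma coupling_diag : thh^T *m y + gam = th^T *m y.
Proof. by rewrite /gam linearB/= mulmxBl addrC subrK. Qed.

Lemma measurable_shift (v : 'cV[R]_n) :
  measurable_fun [set: Rn R n] (fun w : Rn R n => w + v : Rn R n).
Proof. by apply: measurable_addmx => //; exact: measurable_cst. Qed.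

Lemma measurable_coupling : measurable_fun [set: Rn R n] psi.
Proof.
by apply: measurable_fun_pair; apply: measurable_addmx => //; exact: measurable_cst.
Qed.

Lemma measurable_overlap : measurable_fun [set: Rn R n] k.
Proof.
apply: measurable_minr; first exact: measurable_gauss_density.
exact: (measurableT_comp (measurable_gauss_density _ S) (measurable_shift gam)).
Qed.

Lemma overlap_ge0 w : 0 <= k w.
Proof. by rewrite /k le_min !gauss_density_ge0. Qed.

(** Common form of the four upper bounds on v. The translation by v passes from the noise w to the
    next state, over which the Gaussian integrals run. *)
Lemma vker_le (A : set (Rn R n * Rn R n)) (v : 'cV[R]_n) (g : Rn R n -> \bar R) :
  measurable A -> measurable_fun [set: Rn R n] g -> (forall w, (0 <= g w)%E) ->
  (forall w, ((\1_A (psi w) * k w)%:E <= g (w + v)%R)%E) ->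
  (vker f thh th S x x u A <= lebint g)%E.
Proof.
move=> mA mg g0 le_g; rewrite -(@lebint_translate R n v g mg g0).
apply: le_lebint => //.
- exact: (measurable_indic_density psi k measurable_coupling measurable_overlap).
- exact: (measurableT_comp mg (measurable_shift v)).
- exact: (indic_density_ge0 psi k overlap_ge0).
Qed.

Lemma measurable_gauss_integrand (v : 'cV[R]_n) (B : set (Rn R n)) : measurable B ->
  measurable_fun [set: Rn R n]
    (fun w : Rn R n => ((\1_B w)%:E * (gauss_density S (w - v))%:E)%E).
Proof.
move=> mB; apply: emeasurable_funM; apply/measurable_EFinP.
  exact: measurable_indic.
exact: (measurableT_comp (measurable_gauss_density _ S) (measurable_shift (- v))).
Qed.

Lemma vker_measure : exists mu : {measure set (Rn R n * Rn R n)%type -> \bar R},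
  forall A : set (Rn R n * Rn R n)%type, measurable A -> mu A = vker f thh th S x x u A.
Proof.
by exists (density_image_measure psi k measurable_coupling measurable_overlap overlap_ge0).
Qed.

Lemma vker_setT : vker f thh th S x x u setT = lebint (fun w : 'cV[R]_n => (k w)%:E).
Proof. by apply: eq_lebint => w; rewrite indicT mul1r. Qed.

Lemma vker_Rrel : vker f thh th S x x u setT = vker f thh th S x x u (@Rrel R n).
Proof.
apply: eq_lebint => w; rewrite indicT indicE mem_set// /Rrel/=.
by rewrite -/y -/gam coupling_diag.
Qed.

Lemma vker_le1 : sym_posdef S -> (vker f thh th S x x u setT <= 1)%E.
Proof.
move=> Sp; rewrite -(lebint_gauss_density S Sp).
apply: (@vker_le setT 0 (fun w => (gauss_density S w)%:E)) => //.
- by apply/measurable_EFinP; exact: measurable_gauss_density.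
- by move=> w; rewrite lee_fin gauss_density_ge0.
- by move=> w; rewrite indicT mul1r addr0 lee_fin ge_min lexx.
Qed.

(** The nominal next state is thh^T y + gam + w, whose deviation from the nominal mean is w + gam:
    the second density in the minimum. For the other marginal the deviation is w, the first
    density. *)
Lemma vker_fst_le (A : set (Rn R n)) : measurable A ->
  (vker f thh th S x x u (A `*` setT) <= gauss (thh^T *m y) S A)%E.
Proof.
move=> mA; apply: (@vker_le _ (thh^T *m y + gam)); first exact: measurableX.
- exact: measurable_gauss_integrand.
- by move=> w; rewrite mule_ge0// lee_fin ?gauss_density_ge0.
move=> w; rewrite -EFinM lee_fin indicE in_setX in_setT andbT -indicE/=.
rewrite [_ + w]addrC ler_wpM2l// /k.
rewrite (_ : w + (thh^T *m y + gam) - thh^T *m y = w + gam); last first.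
  by rewrite [_ + gam]addrC addrA addrK.
by rewrite ge_min lexx orbT.
Qed.

Lemma vker_snd_le (B : set (Rn R n)) : measurable B ->
  (vker f thh th S x x u (setT `*` B) <= gauss (th^T *m y) S B)%E.
Proof.
move=> mB; apply: (@vker_le _ (th^T *m y)); first exact: measurableX.
- exact: measurable_gauss_integrand.
- by move=> w; rewrite mule_ge0// lee_fin ?gauss_density_ge0.
move=> w; rewrite -EFinM lee_fin indicE in_setX in_setT/= -indicE/=.
by rewrite [_ + w]addrC ler_wpM2l// /k addrK ge_min lexx.
Qed.

(** At equal states the correction in the state mapping vanishes, so the refined pair is (x+, x+),
    exactly the form of the values of [psi]. *)
Lemma vker_refinement (A : set (Rn R n * Rn R n)) : measurable A ->
  (vker f thh th S x x u A <= gauss_int (th^T *m y) S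
     (fun xp => (\1_A (xp + thh^T *m (f x u - f x u), xp))%:E))%E.
Proof.
move=> mA; apply: (@vker_le _ (th^T *m y)) => //.
- rewrite subrr mulmx0; under eq_fun do rewrite addr0.
  have mdiag : measurable_fun [set: Rn R n] (fun w : Rn R n => (w, w)).
    exact: measurable_fun_pair.
  apply: emeasurable_funM; apply/measurable_EFinP.
    exact: (measurableT_comp (measurable_indic mA) mdiag).
  exact: (measurableT_comp (measurable_gauss_density _ S) (measurable_shift _)).
- by move=> w; rewrite mule_ge0// lee_fin ?gauss_density_ge0.
move=> w; rewrite -EFinM lee_fin subrr mulmx0 addr0 /psi coupling_diag [_ + w]addrC.
by rewrite ler_wpM2l// /k addrK ge_min lexx.
Qed.

End CouplingKernel.

Theorem theorem5 (R : realType) (n m : nat)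
  (dU : measure_display) (U : measurableType dU)
  (dY : measure_display) (Y : measurableType dY)
  (f : 'cV[R]_n -> U -> 'cV[R]_m) (h : 'cV[R]_n -> Y) (S : 'M[R]_n)
  (N : nat) (xs : 'I_N -> 'cV[R]_n) (us : 'I_N -> U) (xps : 'I_N -> 'cV[R]_n)
  (mu0 : 'cV[R]_(n * m)) (S0 : 'M[R]_(n * m)) (alpha : R) :
  (0 < n)%N -> (0 < m)%N ->
  (forall k : 'I_m,
     measurable_fun setT (fun p : (Rn R n * U)%type => f p.1 p.2 k ord0)) ->
  measurable_fun setT (h : Rn R n -> Y) ->
  sym_posdef S -> sym_posdef S0 -> 0 < alpha < 1 ->
  let SN := SigmaN f S S0 xs us in
  let mN := muN f S mu0 S0 xs us xps in
  let thh := thetahat f S mu0 S0 xs us xps in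
  let Theta := credible_set mN SN alpha in
  let r := specnorm (invmx S) * specnorm SN * n%:R * chi2_quantile n (1 - alpha) in
  let delta (xh : 'cV[R]_n) (u : U) :=
    1 - 2 * normal_cdf (- (Num.sqrt r / 2 * enorm (f xh u))) in
  forall th : 'M[R]_(m, n), Theta th ->
    (* (i) (0, delta)-sub-simulation relation between M(thh) and M(th) *)
    ((forall x0 : 'cV[R]_n, Rrel (x0, x0)) /\
     (forall (xh x : 'cV[R]_n) (u : U), Rrel (xh, x) ->
        (exists mu : {measure set (Rn R n * Rn R n)%type -> \bar R},
           forall A : set (Rn R n * Rn R n)%type, measurable A ->
             mu A = vker f thh th S xh x u A) /\
        (vker f thh th S xh x u setT <= 1)%E /\
        vker f thh th S xh x u setT = vker f thh th S xh x u (@Rrel R n) /\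
        ((1 - delta xh u)%:E <= vker f thh th S xh x u (@Rrel R n))%E /\
        (forall A : set (Rn R n), measurable A ->
           (vker f thh th S xh x u (A `*` setT)
             <= gauss (thh^T *m f xh u) S A)%E) /\
        (forall B : set (Rn R n), measurable B ->
           (vker f thh th S xh x u (setT `*` B)
             <= gauss (th^T *m f x u) S B)%E) /\
        h xh = h x)) /\
    (* (ii) the state mapping s gives a valid control refinement *)
    (forall (xh x : 'cV[R]_n) (u : U), Rrel (xh, x) ->
       forall A : set (Rn R n * Rn R n)%type, measurable A ->
         (vker f thh th S xh x u A
          <= gauss_int (th^T *m f x u) S
               (fun xp => (\1_A (xp + thh^T *m (f xh u - f x u), xp))%:E))%E).
Proof.
move=> _ _ _ _ Sp S0p _ SN mN thh Theta r delta th thTheta; split; last first.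
  by move=> xh x u; rewrite /Rrel/= => -> A mA; exact: vker_refinement.
split=> // xh x u; rewrite /Rrel/= => ->.
split; first exact: vker_measure.
split; first exact: vker_le1.
split; first exact: vker_Rrel.
split; last first.
  split; first by move=> A mA; exact: vker_fst_le.
  by split=> // B mB; exact: vker_snd_le.
rewrite -vker_Rrel vker_setT; apply: le_trans (overlap_ge _ _ Sp).
(* Since 1 - delta is twice a value of the cdf, monotonicity leaves the comparison of the two
   arguments. *)
rewrite lee_fin /delta opprB addrC subrK ler_pM2l// normal_cdf_le//.
rewrite lerN2 mulrAC ler_pM2r ?invr_gt0//.
have dev := credible_deviation (f x u) Sp S0p thTheta.
apply: le_trans (ler_wsqrtr dev) _.
(* [sqrtrM] asks for the sign of its left factor, which is evident for the square of the norm; hence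
   the commutation. *)
rewrite -/SN -/r mulrC sqrtrM ?sqr_ge0// sqrtr_sqr ger0_norm ?enorm_ge0//.
by rewrite mulrC.
Qed.
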